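(* Let $(\mathsf K,\mathsf D)$ be a differential ring with a ring automorphism $a\mapsto a\circ\lambda$ and a central unit $\lambda'$ with all $\mathsf D^j(\lambda')$ central, satisfying $\mathsf D(a\circ\lambda)=\lambda'(\mathsf Da)\circ\lambda$; set $\sigma=(\lambda')^{-1}$ and $S(\lambda)=\lambda'''/\lambda'-\frac32(\lambda''/\lambda')^2$ (primes denoting $\mathsf D$-derivatives). Let $L=\sum_{i=0}^n\binom ni a_i\mathsf D^{n-i}$ ($a_0=1$) and $\widehat L^\lambda:=\sigma^{-n}\sum_{i=0}^n\binom ni(a_i\circ\lambda)(\sigma\mathsf D)^{n-i}$. For any monic operator $M$ with first coefficient $b_1$, define $$W_2(M)=I_2(M),\quad W_3(M)=I_3(M)-\tfrac32\Delta_{b_1}(I_2(M)),$$ $$W_4(M)=I_4(M)-2\Delta_{b_1}(I_3(M))+\tfrac65\Delta_{b_1}^2(I_2(M))-\tfrac{3(5n+7)}{5(n+1)}I_2(M)^2,$$ and write $W_k=W_k(L)$, $W_k^\lambda=W_k(\widehat L^\lambda)$. Then for $n\ge 3$, $$W_2^\lambda=(\lambda')^2(W_2\circ\lambda)+\frac{n+1}{6}S(\lambda),\qquad W_3^\lambda=(\lambda')^3(W_3\circ\lambda),$$ and for $n\ge4$, $W_4^\lambda=(\lambda')^4(W_4\circ\lambda)$.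
   Context: $\mathsf K$ is a unital associative (possibly noncommutative) ring with derivation $\mathsf D$; Ore algebra $\mathsf K\langle\mathsf D\rangle$ with $\mathsf D a=a\mathsf D+\mathsf D(a)$. For a monic operator $M=\sum_k\binom nk b_k\mathsf D^{n-k}$ ($b_0=1$), $I_k(M)$ are the unique elements with $M=(\mathsf D+b_1)^n+\sum_{k=2}^n\binom nk I_k(M)(\mathsf D+b_1)^{n-k}$, and $\Delta_{b_1}(x)=\mathsf D(x)+b_1x-xb_1$. *)

(* Defs.v *)
(* Differential operators over a (possibly noncommutative)
   ring K with derivation D, represented as left-coefficient polynomials
   sum_i p_i D^i, stored in {poly K} ('X plays the role of D), with the
   Ore multiplication  D a = a D + D(a). *)
From HB Require Import structures.
From mathcomp Require Import all_boot all_order all_algebra.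
Set Implicit Arguments. Unset Strict Implicit. Unset Printing Implicit Defensive.
Import Order.TTheory GRing.Theory.
Local Open Scope ring_scope.

Section Ore.
Variable K : unitRingType.
Variable D : K -> K.

Definition omul (p q : {poly K}) : {poly K} :=
  \sum_(i < size p) \sum_(j < size q) \sum_(k < i.+1)
     (p`_i * 'C(i, k)%:R * iter k D q`_j) *: 'X^(i + j - k).

Fixpoint opow (p : {poly K}) (m : nat) : {poly K} :=
  match m with 0 => 1 | m'.+1 => omul p (opow p m') end.

(* Coefficients c_j (j < m) of P in the basis ((D + c)^j)_j, obtained by
   successively removing the top term: P = sum_(j<m) c_j (D+c)^j
   whenever size P <= m. *)
Fixpoint bcoef (c : K) (m : nat) (P : {poly K}) (j : nat) : K :=
  match m with
  | 0 => 0
  | m'.+1 => if j == m' then P`_m'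
             else bcoef c m' (P - P`_m' *: opow ('X + c%:P) m') j
  end.

(* M monic of order n: M = sum_k C(n,k) b_k D^(n-k);  b_1 = M_(n-1) / n *)
Definition b1 (n : nat) (M : {poly K}) : K := (n%:R)^-1 * M`_(n.-1).

(* I_k(M): M = (D+b1)^n + sum_(k=2)^n C(n,k) I_k(M) (D+b1)^(n-k) *)
Definition Ik (n : nat) (M : {poly K}) (k : nat) : K :=
  ('C(n, k)%:R)^-1 * bcoef (b1 n M) n.+1 M (n - k).

Definition Delta (c x : K) : K := D x + c * x - x * c.

Definition qfrac (p q : nat) : K := p%:R / q%:R.

Definition W2 (n : nat) (M : {poly K}) : K := Ik n M 2.
Definition W3 (n : nat) (M : {poly K}) : K :=
  Ik n M 3 - qfrac 3 2 * Delta (b1 n M) (Ik n M 2).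
Definition W4 (n : nat) (M : {poly K}) : K :=
  Ik n M 4 - 2%:R * Delta (b1 n M) (Ik n M 3)
  + qfrac 6 5 * Delta (b1 n M) (Delta (b1 n M) (Ik n M 2))
  - qfrac (3 * (5 * n + 7)) (5 * (n + 1)) * (Ik n M 2 * Ik n M 2).

Definition Lop (n : nat) (a : nat -> K) : {poly K} :=
  \sum_(i < n.+1) ('C(n, i)%:R * a i) *: 'X^(n - i).

(* \hat L^lambda = sigma^(-n) sum_i C(n,i) (a_i o lambda) (sigma D)^(n-i),
   sigma = lp^-1, so sigma^(-n) = lp^n *)
Definition Lhat (phi : K -> K) (lp : K) (n : nat) (a : nat -> K) : {poly K} :=
  omul ((lp ^+ n)%:P)
    (\sum_(i < n.+1) ('C(n, i)%:R * phi (a i)) *: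
        opow (omul ((lp^-1)%:P) 'X) (n - i)).

Definition Schwarz (lp : K) : K :=
  D (D lp) / lp - qfrac 3 2 * ((D lp / lp) * (D lp / lp)).

End Ore.

(* Main.v *)
Require Import Defs.
From HB Require Import structures.
From mathcomp Require Import all_boot all_order all_algebra.
From mathcomp.classical Require Import boolp.
From mathcomp Require Import ring.
Import GRing.Theory.
Local Open Scope ring_scope.
Set Implicit Arguments.
Unset Strict Implicit.
Unset Printing Implicit Defensive.

(** Write [sigma = lp^-1], [c = lp * phi b_1], [E = D + c] and [u = lp'/lp].  Pulling
    back along [phi] is a ring morphism of Ore algebras sending [D] to [sigma D], hence
    [D + b_1] to [sigma E]; so
    [Lhat = sum_k C(n,k) lp^k phi(I_k) (lp^(n-k) (sigma E)^(n-k))].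
    Here [lp^m (sigma E)^m = (E - (m-1)u) ... (E - u) E] has its coefficients in the
    commutative ring of elements all of whose derivatives are central.  Re-expanding it in
    powers of [F = E - (n-1)u/2] gives closed forms, polynomial in [m] and [n], for the
    first four coefficients.  At [m = n] the coefficient of [F^(n-1)] vanishes, so [F] is
    [D + b_1(Lhat)], and the next ones are expressed through
    [s = (n+1)/6 S(lambda)] alone.  This yields [I_2, I_3, I_4] of [Lhat]; since
    [Delta (lp^k phi x) = k u lp^k phi x + lp^(k+1) phi (Delta x)], the combinations
    [W_3] and [W_4] are exactly those in which [u] and [s] cancel. *)

(** * The differential centre *)

Section Derivation.
Variables (K : unitRingType) (D : K -> K).
Hypothesis D_add : forall x y, D (x + y) = D x + D y.
Hypothesis D_mul : forall x y, D (x * y) = D x * y + x * D y.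

Lemma der0 : D 0 = 0.
Proof. by apply: (addrI (D 0)); rewrite -D_add !addr0. Qed.

Lemma derN x : D (- x) = - D x.
Proof. by apply: (addrI (D x)); rewrite -D_add !subrr der0. Qed.

Lemma der1 : D 1 = 0.
Proof. by apply: (addrI (D 1)); rewrite addr0 -[in RHS](mulr1 1) D_mul mulr1 mul1r. Qed.

Lemma der_nat m : D m%:R = 0.
Proof. by elim: m => [|m IH]; rewrite ?der0 // -natr1 D_add IH der1 addr0. Qed.

Lemma der_inv x : x \is a GRing.unit -> D x^-1 = - (x^-1 * D x * x^-1).
Proof.
move=> xu; apply: (mulrI xu); apply: (addrI (D x * x^-1)).
by rewrite -D_mul divrr // der1 mulrN !mulrA divrr // mul1r subrr.
Qed.

Lemma iter_derD j x y : iter j D (x + y) = iter j D x + iter j D y.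
Proof. by elim: j => //= j ->; rewrite D_add. Qed.

Lemma iter_derN j x : iter j D (- x) = - iter j D x.
Proof. by elim: j => //= j ->; rewrite derN. Qed.

(* Bounding the order of the derivatives lets closure under products and inverses be
   proved by induction, as [D (x * y)] and [D x^-1] only involve lower orders. *)
Definition central_upto j (x : K) :=
  forall i, (i <= j)%N -> forall y, iter i D x * y = y * iter i D x.

Definition dcentral (x : K) := forall i y, iter i D x * y = y * iter i D x.

Lemma central_uptoS j x :
  central_upto j.+1 x <-> central_upto 0 x /\ central_upto j (D x).
Proof.
split=> [cx | [c0 cx] [|i] ij].
- split=> i ij; first by apply: cx; rewrite (leq_trans ij).
  by move=> y; rewrite -iterSr; apply: cx.
- exact: c0.
- by move=> y; rewrite iterSr; apply: cx.
Qed.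

Lemma central_uptoW i j x : (i <= j)%N -> central_upto j x -> central_upto i x.
Proof. by move=> ij cx k ki; apply: cx; apply: leq_trans ij. Qed.

Lemma central_uptoD j x y :
  central_upto j x -> central_upto j y -> central_upto j (x + y).
Proof. by move=> cx cy i ij z; rewrite iter_derD mulrDl mulrDr cx ?cy. Qed.

Lemma central_uptoN j x : central_upto j x -> central_upto j (- x).
Proof. by move=> cx i ij z; rewrite iter_derN mulNr mulrN cx. Qed.

Lemma central_uptoM j x y :
  central_upto j x -> central_upto j y -> central_upto j (x * y).
Proof.
elim: j x y => [|j IH] x y cx cy.
  case=> // _ z /=; rewrite -mulrA (cy 0%N) // mulrA (cx 0%N) // -mulrA.
  by [].
case/central_uptoS: (cx) => cx0 cDx; case/central_uptoS: (cy) => cy0 cDy.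
apply/central_uptoS; split.
  case=> // _ z /=; rewrite -mulrA (cy0 0%N) // mulrA (cx0 0%N) // -mulrA.
  by [].
have cxj := central_uptoW (leqnSn j) cx; have cyj := central_uptoW (leqnSn j) cy.
by rewrite D_mul; apply: central_uptoD; apply: IH.
Qed.

Lemma central_upto0V x :
  x \is a GRing.unit -> central_upto 0 x -> central_upto 0 x^-1.
Proof.
move=> xu cx [] // _ y /=; apply: (mulrI xu).
by rewrite mulVKr // mulrA (cx 0%N) // mulrK.
Qed.

Lemma central_uptoV j x :
  x \is a GRing.unit -> central_upto j x -> central_upto j x^-1.
Proof.
move=> xu; elim: j => [|j IH] cx; first exact: central_upto0V.
case/central_uptoS: (cx) => cx0 cDx.
have cV := IH (central_uptoW (leqnSn j) cx).
apply/central_uptoS; split; first exact: central_upto0V.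
rewrite der_inv //; apply: central_uptoN.
by apply: central_uptoM => //; apply: central_uptoM.
Qed.

Lemma dcentralE x : dcentral x <-> forall j, central_upto j x.
Proof. by split=> [cx j i _|cx j]; [exact: cx | exact: (cx j j)]. Qed.

Lemma dcentral_der x : dcentral x -> dcentral (D x).
Proof. by move=> cx i y; rewrite -iterSr cx. Qed.

Lemma dcentralV x : x \is a GRing.unit -> dcentral x -> dcentral x^-1.
Proof. by move=> xu /dcentralE cx; apply/dcentralE => j; apply: central_uptoV. Qed.

Lemma dcentralM x y : dcentral x -> dcentral y -> dcentral (x * y).
Proof.
by move=> /dcentralE cx /dcentralE cy; apply/dcentralE => j; apply: central_uptoM.
Qed.

Lemma dcentral_nat m : dcentral m%:R.
Proof.
case=> [|i] y; first by rewrite /= commr_nat.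
have i0 : iter i D 0 = 0 by elim: i => //= i ->; rewrite der0.
by rewrite iterSr der_nat i0 mul0r mulr0.
Qed.

(** The classical [asbool] makes membership Boolean, as the subring and subtype structures
    require. *)
Definition dcenter : {pred K} := fun x => `[< dcentral x >].

Lemma dcenterP x : reflect (dcentral x) (x \in dcenter).
Proof. exact: asboolP. Qed.

Lemma dcenter_subring : subring_closed dcenter.
Proof.
split=> [|x y /dcenterP/dcentralE cx /dcenterP/dcentralE cy|
         x y /dcenterP cx /dcenterP cy]; apply/dcenterP.
- exact: (dcentral_nat 1).
- by apply/dcentralE => j; apply/central_uptoD/central_uptoN.
- exact: dcentralM.
Qed.

HB.instance Definition _ := GRing.isSubringClosed.Build K dcenter dcenter_subring.

Definition dcent := {x : K | x \in dcenter}.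
HB.instance Definition _ := [isSub of dcent for @sval K _].
HB.instance Definition _ := [Choice of dcent by <:].
HB.instance Definition _ := [SubChoice_isSubNzRing of dcent by <:].

Lemma dcent_mulC : commutative (@GRing.mul dcent).
Proof. by move=> x y; apply: val_inj; rewrite !rmorphM; apply: (dcenterP _ (valP x) 0%N). Qed.

HB.instance Definition _ := GRing.PzRing_hasCommutativeMul.Build dcent dcent_mulC.

(** Hides the subtype behind an abstract commutative ring: scalar computations take place in [R],
    where [ring] applies, and return to [K] through [i]. *)
Lemma differential_center :
  exists (R : comNzRingType) (d : R -> R) (i : {rmorphism R -> K}),
    [/\ injective i, forall z, i (d z) = D (i z),
        forall z x, i z * x = x * i z & forall x, dcentral x -> exists z, i z = x].
Proof.
pose d (z : dcent) : dcent :=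
  Sub (D (val z)) (introT (dcenterP _) (dcentral_der (dcenterP _ (valP z)))).
exists dcent, d, (\val : {rmorphism dcent -> K}); split.
- exact: val_inj.
- by [].
- by move=> z x; apply: (dcenterP _ (valP z) 0%N).
- by move=> x /dcenterP cx; exists (Sub x cx).
Qed.
End Derivation.

(** * Coefficients of the pulled-back power of D *)

Section Scalars.
Variables (R : comNzRingType) (d : R -> R).
Hypothesis dD : forall x y, d (x + y) = d x + d y.
Hypothesis dM : forall x y, d (x * y) = d x * y + x * d y.
Hypothesis dnat : forall m, d m%:R = 0.
Hypothesis dN : forall x, d (- x) = - d x.
Hypothesis natr_reg : forall m (x y : R), m.+1%:R * x = m.+1%:R * y -> x = y.

(* [pcoef h u m k] is the coefficient of [F^(m-k)] in
   [(F + h - (m-1) u) ... (F + h - u) (F + h)], for [F] inducing the derivation [d]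
   on central elements; [h2] below specializes [h] to the shift [(n-1)u/2]. *)
Fixpoint pcoef (h u : R) (m k : nat) {struct m} : R :=
  match m, k with
  | 0, 0 => 1
  | 0, _.+1 => 0
  | m'.+1, 0 => pcoef h u m' 0
  | m'.+1, k'.+1 =>
      pcoef h u m' k'.+1 + d (pcoef h u m' k') + (h - m'%:R * u) * pcoef h u m' k'
  end.

(** Certificate of ideal membership: the cofactors are given explicitly and [ring] checks a single
    identity. Shorter certificates repeat an equation with cofactor 0. *)
Lemma eq_of_lincomb4 (a b c e x1 y1 x2 y2 x3 y3 x4 y4 x y : R) :
  x1 = y1 -> x2 = y2 -> x3 = y3 -> x4 = y4 ->
  x - y = a * (x1 - y1) + b * (x2 - y2) + c * (x3 - y3) + e * (x4 - y4) -> x = y.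
Proof.
move=> -> -> -> ->; rewrite !subrr !mulr0 !addr0 => /eqP.
by rewrite subr_eq0 => /eqP.
Qed.

Variables (n : nat) (h u : R).
Hypothesis h2 : 2%:R * h = (n%:R - 1) * u.
Local Notation p := (pcoef h u).

Lemma pcoef0 m : p m 0 = 1. Proof. by elim: m. Qed.

Lemma d_one : d 1 = 0. Proof. exact: (dnat 1). Qed.

Ltac der_simp := rewrite ?(dD, dM, dN, dnat, d_one).

Lemma pcoef1 m : 2%:R * p m 1 = m%:R * (n%:R - m%:R) * u.
Proof.
elim: m => [|m IH]; first by rewrite /=; ring.
rewrite /= pcoef0 d_one.
apply: (eq_of_lincomb4 IH h2 IH IH (a := 1) (b := 1) (c := 0) (e := 0)).
by rewrite -natr1; ring.
Qed.

(** Induction on [m], as in the next two lemmas: the closed form of the previous coefficient and its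
    derivative are inserted in the recurrence. Denominators are cleared because [R] only cancels
    positive integers, through [natr_reg]. *)
Lemma pcoef2 m : 24%:R * p m 2 = m%:R * (m%:R - 1) *
  (2%:R * (3%:R * n%:R + 1 - 2%:R * m%:R) * d u
   + (3%:R * m%:R ^+ 2 - 6%:R * m%:R * n%:R - m%:R + 3%:R * n%:R ^+ 2 - 1) * (u * u)).
Proof.
elim: m => [|m IH]; first by rewrite /=; ring.
have e1 := pcoef1 m; have e2 : d (2%:R * p m 1) = d (m%:R * (n%:R - m%:R) * u) by rewrite e1.
move: e2; der_simp => e2.
rewrite [p m.+1 2]/=.
move: IH h2 e1 e2; set P2 := p m 2; set P1 := p m 1; set D1 := d P1.
set u1 := d u => IH H2 e1 e2.
(* The cofactors follow 24 times the recurrence: [12 * 2] matches the derivative of [2 P1], [H2]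
   turns [24 h] into [12 (n-1) u], and [e1] then eliminates [P1]. *)
apply: (eq_of_lincomb4 IH e2 H2 e1 (a := 1) (b := 12%:R) (c := 12%:R * P1)
   (e := 6%:R * ((n%:R - 1 - 2%:R * m%:R) * u))).
by rewrite -natr1; ring.
Qed.

Lemma pcoef3 m : 48%:R * p m 3 = m%:R * (m%:R - 1) * (m%:R - 2%:R) *
  (2%:R * (2%:R * n%:R + 1 - m%:R) * d (d u)
   + 2%:R * (2%:R * m%:R ^+ 2 - 5%:R * m%:R * n%:R - 2%:R * m%:R
       + 3%:R * n%:R ^+ 2 + n%:R - 1) * (u * d u)
   + ((n%:R - m%:R) ^+ 3 + (m%:R ^+ 2 - m%:R * n%:R + m%:R - n%:R)) * (u * (u * u))).
Proof.
elim: m => [|m IH]; first by rewrite /=; ring.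
have e1 := pcoef2 m.
have e2 : d (24%:R * p m 2) = d (m%:R * (m%:R - 1) *
  (2%:R * (3%:R * n%:R + 1 - 2%:R * m%:R) * d u
   + (3%:R * m%:R ^+ 2 - 6%:R * m%:R * n%:R - m%:R + 3%:R * n%:R ^+ 2 - 1) * (u * u))).
  by rewrite e1.
move: e2; rewrite !expr2; der_simp => e2.
rewrite [p m.+1 3]/=.
move: IH h2 e1 e2; set P3 := p m 3; set P1 := p m 2; set D1 := d P1.
set u2 := d (d u); set u1 := d u => IH H2 e1 e2.
apply: (eq_of_lincomb4 IH e2 H2 e1 (a := 1) (b := 2%:R) (c := 24%:R * P1)
   (e := (n%:R - 1 - 2%:R * m%:R) * u)).
by rewrite -natr1; ring.
Qed.

Lemma pcoef4 m : 5760%:R * p m 4 = m%:R * (m%:R - 1) * (m%:R - 2%:R) * (m%:R - 3%:R) *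
  (24%:R * (5%:R * n%:R + 3%:R - 2%:R * m%:R) * d (d (d u))
   + 4%:R * (20%:R * m%:R ^+ 2 - 60%:R * m%:R * n%:R - 36%:R * m%:R + 45%:R * n%:R ^+ 2
       + 30%:R * n%:R - 11%:R) * (d u * d u)
   + 24%:R * (5%:R * m%:R ^+ 2 - 15%:R * m%:R * n%:R - 8%:R * m%:R + 10%:R * n%:R ^+ 2
       + 5%:R * n%:R - 3%:R) * (u * d (d u))
   + 4%:R * (- 30%:R * m%:R ^+ 3 + 105%:R * m%:R ^+ 2 * n%:R + 55%:R * m%:R ^+ 2
       - 120%:R * m%:R * n%:R ^+ 2 - 75%:R * m%:R * n%:R + 33%:R * m%:R + 45%:R * n%:R ^+ 3
       + 15%:R * n%:R ^+ 2 - 45%:R * n%:R - 7%:R) * (u * (u * d u))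
   + (15%:R * (n%:R - m%:R) ^+ 4 - 30%:R * m%:R ^+ 3 + 60%:R * m%:R ^+ 2 * n%:R
       - 25%:R * m%:R ^+ 2 - 30%:R * m%:R * n%:R ^+ 2 + 60%:R * m%:R * n%:R + 12%:R * m%:R
       - 30%:R * n%:R ^+ 2 + 7%:R) * (u * (u * (u * u)))).
Proof.
elim: m => [|m IH]; first by rewrite /=; ring.
have e1 := pcoef3 m.
have e2 := f_equal d e1.
move: e2; rewrite !exprS !expr0 !mulr1; der_simp => e2.
rewrite [p m.+1 4]/=.
move: IH h2 e1 e2; set P3 := p m 4; set P1 := p m 3; set D1 := d P1.
set u3 := d (d (d u)); set u2 := d (d u); set u1 := d u => IH H2 e1 e2.
apply: (eq_of_lincomb4 IH e2 H2 e1 (a := 1) (b := 120%:R) (c := 2880%:R * P1)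
   (e := 60%:R * (n%:R - 1 - 2%:R * m%:R) * u)).
by rewrite -natr1; ring.
Qed.

Lemma binr2 m : 2%:R * 'C(m, 2)%:R = m%:R * (m%:R - 1) :> R.
Proof.
elim: m => [|m IH]; first by rewrite bin0n /=; ring.
rewrite binS bin1 natrD mulrDr IH -natr1; ring.
Qed.

Lemma binr3 m : 6%:R * 'C(m, 3)%:R = m%:R * (m%:R - 1) * (m%:R - 2%:R) :> R.
Proof.
elim: m => [|m IH]; first by rewrite bin0n /=; ring.
rewrite binS natrD mulrDr IH.
have -> : 6%:R * 'C(m, 2)%:R = 3%:R * (2%:R * 'C(m, 2)%:R) :> R by ring.
by rewrite binr2 -natr1; ring.
Qed.

Lemma binr4 m : 24%:R * 'C(m, 4)%:R = m%:R * (m%:R - 1) * (m%:R - 2%:R) * (m%:R - 3%:R) :> R.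
Proof.
elim: m => [|m IH]; first by rewrite bin0n /=; ring.
rewrite binS natrD mulrDr IH.
have -> : 24%:R * 'C(m, 3)%:R = 4%:R * (6%:R * 'C(m, 3)%:R) :> R by ring.
by rewrite binr3 -natr1; ring.
Qed.

(** * Values at [m = n], then at [m = n-2] and [m = n-3] *)

Variable s : R.
Hypothesis sE : 12%:R * s = (n%:R + 1) * (2%:R * d u - u * u).

Lemma pcoef_top1 : p n 1 = 0.
Proof. by apply: (@natr_reg 1); rewrite pcoef1 subrr mulr0 mul0r mulr0. Qed.

(** At [m = n] the closed form collapses to [n(n-1)(n+1)(2u' - u^2)], and [sE] recognises [s] in
    it. *)
Lemma pcoef_top2 : p n 2 = 'C(n, 2)%:R * s.
Proof.
apply: (@natr_reg 23); rewrite pcoef2.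
apply: (eq_of_lincomb4 (binr2 n) sE sE sE
  (a := - (12%:R * s)) (b := - (n%:R * (n%:R - 1))) (c := 0) (e := 0)).
ring.
Qed.

Lemma der_s : 12%:R * d s = (n%:R + 1) * (2%:R * d (d u) - 2%:R * (u * d u)).
Proof.
have := f_equal d sE; der_simp => H.
by apply: (eq_of_lincomb4 H H H H (a := 1) (b := 0) (c := 0) (e := 0)); ring.
Qed.

Lemma der2_s : 12%:R * d (d s) =
  (n%:R + 1) * (2%:R * d (d (d u)) - 2%:R * (d u * d u) - 2%:R * (u * d (d u))).
Proof.
have := f_equal d der_s; der_simp => H.
by apply: (eq_of_lincomb4 H H H H (a := 1) (b := 0) (c := 0) (e := 0)); ring.
Qed.

Lemma pcoef_top3 : 2%:R * p n 3 = 'C(n, 3)%:R * (3%:R * d s).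
Proof.
apply: (@natr_reg 23).
have -> : 24%:R * (2%:R * p n 3) = 48%:R * p n 3 by ring.
rewrite pcoef3.
apply: (eq_of_lincomb4 (binr3 n) der_s der_s der_s
  (a := - (12%:R * d s)) (b := - (n%:R * (n%:R - 1) * (n%:R - 2%:R))) (c := 0) (e := 0)).
ring.
Qed.

(** Source of the constant [3(5n+7)/(5(n+1))] of [W_4]. The factor [n+1] stays on the left because
    [s^2] carries [(n+1)^2], while the polynomial in [u] carries [n+1] only once. *)
Lemma pcoef_top4 : 5%:R * (n%:R + 1) * p n 4 = 'C(n, 4)%:R *
  (9%:R * (n%:R + 1) * d (d s) + 3%:R * (5%:R * n%:R + 7%:R) * (s * s)).
Proof.
apply: (@natr_reg 1151).
have -> : 1152%:R * (5%:R * (n%:R + 1) * p n 4) = (n%:R + 1) * (5760%:R * p n 4) by ring.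
rewrite pcoef4.
set f := n%:R * (n%:R - 1) * (n%:R - 2%:R) * (n%:R - 3%:R).
(* With [B = (n+1)(2u' - u^2)], the two copies of [sE] have cofactors proportional to [12 s] and
   [B], so they add up to the difference of squares [(12 s)^2 - B^2]. *)
apply: (eq_of_lincomb4 (binr4 n) der2_s sE sE
  (a := - (48%:R * (9%:R * (n%:R + 1) * d (d s) + 3%:R * (5%:R * n%:R + 7%:R) * (s * s))))
  (b := - f * 36%:R * (n%:R + 1))
  (c := - f * (5%:R * n%:R + 7%:R) * 12%:R * s)
  (e := - f * (5%:R * n%:R + 7%:R) * ((n%:R + 1) * (2%:R * d u - u * u)))).
rewrite /f.
ring.
Qed.

(** Contribution of [I_2] to the new [I_3]: here [p k 1 = (n-2) u], and [C(n,2)(n-2) = 3 C(n,3)].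
    The next two lemmas serve in the same way for [I_3] and [I_2] in the new [I_4]. Writing [n] as a
    successor avoids truncated subtraction. *)
Lemma pcoef_sub21 k : n = k.+2 -> 'C(n, 2)%:R * p k 1 = 'C(n, 3)%:R * (3%:R * u).
Proof.
move=> nk; have e := pcoef1 k; have b2 := binr2 n; have b3 := binr3 n.
apply: (@natr_reg 3).
have nE : n%:R = k%:R + 2%:R :> R by rewrite nk -addn2 natrD.
rewrite nE in e b2 b3.
apply: (eq_of_lincomb4 e b2 b3 b3 (a := 2%:R * 'C(n, 2)%:R) (b := 2%:R * k%:R * u)
   (c := - (2%:R * u)) (e := 0)).
ring.
Qed.

Lemma pcoef_sub31 k : n = k.+3 -> 'C(n, 3)%:R * p k 1 = 'C(n, 4)%:R * (6%:R * u).
Proof.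
move=> nk; have e := pcoef1 k; have b2 := binr3 n; have b3 := binr4 n.
apply: (@natr_reg 11).
have nE : n%:R = k%:R + 3%:R :> R by rewrite nk -addn3 natrD.
rewrite nE in e b2 b3.
apply: (eq_of_lincomb4 e b2 b3 b3 (a := 6%:R * 'C(n, 3)%:R) (b := 3%:R * k%:R * u)
   (c := - (3%:R * u)) (e := 0)).
ring.
Qed.

Lemma pcoef_sub22 k : n = k.+2 -> 2%:R * ('C(n, 2)%:R * p k 2) =
  'C(n, 4)%:R * (2%:R * (n%:R + 5%:R) * d u + (13%:R - n%:R) * (u * u)).
Proof.
move=> nk; have e := pcoef2 k; have b2 := binr2 n; have b3 := binr4 n.
apply: (@natr_reg 23).
have nE : n%:R = k%:R + 2%:R :> R by rewrite nk -addn2 natrD.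
rewrite nE in e b2 b3 *.
apply: (eq_of_lincomb4 e b2 b3 b3 (a := 2%:R * 'C(n, 2)%:R)
   (b := k%:R * (k%:R - 1) *
     (2%:R * (3%:R * (k%:R + 2%:R) + 1 - 2%:R * k%:R) * d u
   + (3%:R * k%:R ^+ 2 - 6%:R * k%:R * (k%:R + 2%:R) - k%:R
       + 3%:R * (k%:R + 2%:R) ^+ 2 - 1) * (u * u)))
   (c := - (2%:R * (k%:R + 2%:R + 5%:R) * d u + (13%:R - (k%:R + 2%:R)) * (u * u))) (e := 0)).
ring.
Qed.
End Scalars.

Lemma pcoefS0 (R : comNzRingType) (d : R -> R) h u m :
  pcoef d h u m.+1 0 = pcoef d h u m 0.
Proof. by []. Qed.

Lemma pcoefSS (R : comNzRingType) (d : R -> R) h u m k : pcoef d h u m.+1 k.+1 =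
  pcoef d h u m k.+1 + d (pcoef d h u m k) + (h - m%:R * u) * pcoef d h u m k.
Proof. by []. Qed.

Lemma pcoef_gt (R : comNzRingType) (d : R -> R) (d0 : d 0 = 0) h u m k :
  (m < k)%N -> pcoef d h u m k = 0.
Proof.
elim: m k => [|m IH] [|k] //= mk.
by rewrite !IH ?d0 ?mulr0 ?addr0 // ltnW.
Qed.

Arguments pcoef : simpl never.

(** * Operators D + c and the pullback *)

Section Ore.
Variables (K : unitRingType) (D : K -> K).
Hypothesis D_add : forall x y, D (x + y) = D x + D y.
Hypothesis D_mul : forall x y, D (x * y) = D x * y + x * D y.

Let D0 : D 0 = 0 := der0 D_add.
Let D1 : D 1 = 0 := der1 D_mul.

(* Left multiplication by D + c.  Locked, since otherwise rewriting with laws of sums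
   unfolds [oshift c q]. *)
Fact oshift_key : unit. Proof. exact: tt. Qed.
Definition oshift (c : K) : {poly K} -> {poly K} :=
  locked_with oshift_key (fun q => q * 'X + map_poly D q + c *: q).

Lemma oshiftE c q : oshift c q = q * 'X + map_poly D q + c *: q.
Proof. by rewrite /oshift unlock_with. Qed.

Lemma coef_oshift c q j :
  (oshift c q)`_j = (if j is j'.+1 then q`_j' else 0) + D q`_j + c * q`_j.
Proof.
rewrite oshiftE !coefD coefMX coefZ coef_map_id0; last exact: D0.
by case: j.
Qed.

Lemma oshiftD c p q : oshift c (p + q) = oshift c p + oshift c q.
Proof.
apply/polyP => j; rewrite coefD !coef_oshift !coefD D_add mulrDr.
case: j => [|j]; first by rewrite !add0r addrACA.
by rewrite coefD [RHS]addrACA; congr (_ + _); rewrite addrACA.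
Qed.

Lemma oshift0 c : oshift c 0 = 0.
Proof. by apply: (addrI (oshift c 0)); rewrite -oshiftD !addr0. Qed.

Lemma oshift_sum c I (r : seq I) (P : pred I) (F : I -> {poly K}) :
  oshift c (\sum_(i <- r | P i) F i) = \sum_(i <- r | P i) oshift c (F i).
Proof. by apply: (big_morph (oshift c)); [apply: oshiftD | apply: oshift0]. Qed.

(** [Delta_c(x)] is the commutator of [D + c] with [x]; this is how [Delta] enters the
    invariants. *)
Lemma oshiftZ c x q : oshift c (x *: q) = x *: oshift c q + Delta D c x *: q.
Proof.
apply/polyP => j; rewrite coef_oshift [RHS]coefD !coefZ coef_oshift D_mul /Delta.
have -> : (if j is j'.+1 then (x *: q)`_j' else 0) =
          x * (if j is j'.+1 then q`_j' else 0).
  by case: j => [|j]; rewrite ?mulr0 ?coefZ.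
rewrite !mulrDr !mulrBl !mulrDl !mulrA -!addrA; congr (_ + _).
by rewrite (addrCA _ (D x * _)) [X in _ = _ + (_ + X)]addrC subrK addrCA.
Qed.

Lemma oshift_decomp c q : oshift c q = oshift 0 q + c *: q.
Proof. by rewrite !oshiftE scale0r addr0. Qed.

Lemma omul_widen (p q : {poly K}) m : (size p <= m)%N ->
  omul D p q = \sum_(i < m) \sum_(j < size q) \sum_(k < i.+1)
     (p`_i * 'C(i, k)%:R * iter k D q`_j) *: 'X^(i + j - k).
Proof.
move=> pm; rewrite /omul (big_ord_widen m (fun i => \sum_(j < size q) \sum_(k < i.+1)
     (p`_i * 'C(i, k)%:R * iter k D q`_j) *: 'X^(i + j - k))) //.
rewrite big_mkcond; apply: eq_bigr => i _; case: ltnP => // pi.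
rewrite big1 // => j _; rewrite big1 // => k _.
by rewrite nth_default // !mul0r scale0r.
Qed.

Lemma Delta0 x : Delta D 0 x = D x.
Proof. by rewrite /Delta mul0r mulr0 addr0 subr0. Qed.

Lemma oshiftXn j : oshift 0 'X^j = 'X^(j.+1).
Proof.
rewrite oshiftE scale0r addr0 -exprSr.
have -> : map_poly D 'X^j = 0; last by rewrite addr0.
apply/polyP => i; rewrite coef0 coef_map_id0 ?coefXn; last exact: D0.
exact: der_nat.
Qed.

Lemma poly_coef_sum (q : {poly K}) : q = \sum_(j < size q) q`_j *: 'X^j.
Proof. by rewrite -poly_def coefK. Qed.

(** The products formed by [opow] and [Lhat] have a left factor of order at most 1, so this case is
    enough to trade the triple sum for [oshift]. *)
Lemma omul_size2 (p q : {poly K}) : (size p <= 2)%N ->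
  omul D p q = p`_1 *: oshift 0 q + p`_0 *: q.
Proof.
move=> /(omul_widen q) ->; rewrite !big_ord_recl big_ord0 addr0 addrC /=.
congr (_ + _).
  rewrite [in RHS](poly_coef_sum q) oshift_sum scaler_sumr; apply: eq_bigr => j _.
  rewrite !big_ord_recl big_ord0 addr0 /= !bin0 binn !mulr1 oshiftZ Delta0 oshiftXn.
  by rewrite scalerDr !scalerA /bump /= !add1n subn0 subSS subn0.
rewrite [in RHS](poly_coef_sum q) scaler_sumr; apply: eq_bigr => j _.
by rewrite big_ord_recl big_ord0 addr0 /= bin0 mulr1 scalerA add0n subn0.
Qed.

Lemma opow_shift c m : opow D ('X + c%:P) m = iter m (oshift c) 1.
Proof.
elim: m => //= m ->; rewrite omul_size2 ?size_XaddC //.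
by rewrite !coefD !coefX !coefC /= addr0 add0r scale1r -oshift_decomp.
Qed.

Lemma omul_polyC x q : omul D x%:P q = x *: q.
Proof.
rewrite omul_size2; last exact: leq_trans (size_polyC_leq1 x) _.
by rewrite !coefC /= scale0r add0r.
Qed.

Lemma opow_scale x m :
  opow D (omul D x%:P 'X) m = iter m (fun q => x *: oshift 0 q) 1.
Proof.
elim: m => //= m ->; rewrite omul_polyC omul_size2.
  by rewrite !coefZ !coefX /= mulr1 mulr0 scale0r addr0.
by rewrite (leq_trans (size_scale_leq _ _)) ?size_polyX.
Qed.

(** * Coordinates in the basis of powers of [D + c] *)

Local Notation opw c m := (iter m (oshift c) (1 : {poly K})).

Lemma coef_opw_gt c m j : (m < j)%N -> (opw c m)`_j = 0.
Proof.
elim: m j => [|m IH] [|j] //= mj; first by rewrite coef1.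
by rewrite coef_oshift (IH j) // (IH j.+1 (ltnW mj)) D0 mulr0 !addr0.
Qed.

Lemma coef_opw_top c m : (opw c m)`_m = 1.
Proof.
elim: m => [|m IH] /=; first by rewrite coef1.
by rewrite coef_oshift IH coef_opw_gt ?D0 ?mulr0 ?addr0.
Qed.

Lemma coef_opw_pred c m : (opw c m.+1)`_m = m.+1%:R * c.
Proof.
elim: m => [|m IH]; rewrite iterS coef_oshift coef_opw_top.
  by rewrite D1 !add0r mulr1 mul1r.
by rewrite IH D1 addr0 mulr1 -[in RHS]natr1 mulrDl mul1r.
Qed.

(** Uniqueness of coordinates: [(D + c)^m] is monic of order [m], so the coefficient of ['X^m] is
    the top coordinate, and removing it leaves a shorter sum. *)
Lemma bcoef_sum c m (b : nat -> K) j : (j < m)%N ->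
  bcoef D c m (\sum_(i < m) b i *: opw c i) j = b j.
Proof.
elim: m j => // m IH j; rewrite ltnS => jm /=.
have top : (\sum_(i < m.+1) b i *: opw c i)`_m = b m.
  rewrite big_ord_recr coefD /= coefZ coef_opw_top mulr1 coef_sum big1 ?add0r //.
  by move=> i _; rewrite coefZ coef_opw_gt ?mulr0.
rewrite top opow_shift big_ord_recr addrK; case: eqP => [->|/eqP jnm] //.
by rewrite IH // ltn_neqAle jnm.
Qed.

(** Existence, by the same triangularity: subtracting the top term lowers the size. *)
Lemma bcoef_expand c m (P : {poly K}) : (size P <= m)%N ->
  P = \sum_(j < m) bcoef D c m P j *: opw c j.
Proof.
elim: m P => [|m IH] P sP.
  by rewrite big_ord0; apply/eqP; rewrite -size_poly_leq0.
set Q := P - P`_m *: opow D ('X + c%:P) m.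
have sQ : (size Q <= m)%N.
  apply/leq_sizeP => j mj; rewrite /Q opow_shift coefB coefZ.
  move: mj; rewrite leq_eqVlt => /predU1P[<-|mj].
    by rewrite coef_opw_top mulr1 subrr.
  by rewrite coef_opw_gt // mulr0 subr0 nth_default // (leq_trans sP).
rewrite big_ord_recr /= eqxx -[LHS](subrK (P`_m *: opw c m)); congr (_ + _).
rewrite -opow_shift -/Q [LHS]IH //; apply: eq_bigr => j _.
by rewrite ltn_eqF.
Qed.

Lemma bcoef_top c m (P : {poly K}) : bcoef D c m.+1 P m = P`_m.
Proof. by rewrite /= eqxx. Qed.

(** For monic [P] and invertible [m.+1%:R], this vanishes exactly when [c] is [b1]; the new [b1] is
    recognised this way. *)
Lemma bcoef_pred c m (P : {poly K}) :
  bcoef D c m.+2 P m = P`_m - P`_m.+1 * (m.+1%:R * c).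
Proof.
rewrite -coef_opw_pred -coefZ -coefB -opow_shift.
by rewrite [LHS]/bcoef ltn_eqF // eqxx.
Qed.

(** * The pullback of operators along [phi] *)

Section Pullback.
Variables (phi : {rmorphism K -> K}) (lp : K).
Hypothesis lp_unit : lp \is a GRing.unit.
Hypothesis compat : forall x, D (phi x) = lp * phi (D x).
Local Notation sg := (lp^-1).
Hypothesis sg_central : forall x, sg * x = x * sg.

Definition pull (p : {poly K}) : {poly K} :=
  \sum_(i < size p) phi p`_i *: iter i (fun q => sg *: oshift 0 q) 1.

Lemma pull_widen (p : {poly K}) m : (size p <= m)%N ->
  pull p = \sum_(i < m) phi p`_i *: iter i (fun q => sg *: oshift 0 q) 1.
Proof.
move=> pm; rewrite /pull (big_ord_widen m (fun i => phi p`_i *: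
  iter i (fun q => sg *: oshift 0 q) 1)) //.
rewrite big_mkcond; apply: eq_bigr => i _; case: ltnP => // pi.
by rewrite nth_default // rmorph0 scale0r.
Qed.

Lemma pullD p q : pull (p + q) = pull p + pull q.
Proof.
set m := maxn (size p) (size q).
rewrite (@pull_widen (p + q) m) ?size_polyD //.
rewrite (@pull_widen p m) ?leq_maxl // (@pull_widen q m) ?leq_maxr //.
by rewrite -big_split; apply: eq_bigr => i _; rewrite coefD rmorphD scalerDl.
Qed.

Lemma pull0 : pull 0 = 0.
Proof. by rewrite /pull size_poly0 big_ord0. Qed.

Lemma pull_sum I (r : seq I) (P : pred I) (F : I -> {poly K}) :
  pull (\sum_(i <- r | P i) F i) = \sum_(i <- r | P i) pull (F i).
Proof. by apply: (big_morph pull); [apply: pullD | apply: pull0]. Qed.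

Lemma pullZ x p : pull (x *: p) = phi x *: pull p.
Proof.
rewrite (@pull_widen _ (size p)) ?size_scale_leq // /pull scaler_sumr.
by apply: eq_bigr => i _; rewrite coefZ rmorphM scalerA.
Qed.

Lemma pullXn m : pull 'X^m = iter m (fun q => sg *: oshift 0 q) 1.
Proof.
rewrite (@pull_widen _ m.+1) ?size_polyXn // big_ord_recr /= coefXn eqxx.
rewrite rmorph1 scale1r big1 ?add0r // => i _.
by rewrite coefXn ltn_eqF // rmorph0 scale0r.
Qed.

(** [compat] reads [sg * D (phi x) = phi (D x)], so substituting [sg D] for [D] respects the Ore
    relation; centrality of [sg] moves it past the coefficients. *)
Lemma pull_oshift0 q : pull (oshift 0 q) = sg *: oshift 0 (pull q).
Proof.
rewrite [in LHS](poly_coef_sum q) oshift_sum pull_sum [pull q]/pull oshift_sum scaler_sumr.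
apply: eq_bigr => j _; rewrite !oshiftZ pullD !pullZ oshiftXn !pullXn !Delta0 iterS.
by rewrite [RHS]scalerDr !scalerA compat mulKr // sg_central.
Qed.

Lemma pull_oshift c q : pull (oshift c q) = sg *: oshift (lp * phi c) (pull q).
Proof.
rewrite oshift_decomp pullD pull_oshift0 pullZ [in RHS]oshift_decomp [RHS]scalerDr.
by congr (_ + _); rewrite scalerA mulKr.
Qed.

Lemma pull_opw c m :
  pull (opw c m) = iter m (fun q => sg *: oshift (lp * phi c) q) 1.
Proof.
elim: m => [|m IH]; last by rewrite iterS pull_oshift IH.
exact: (pullXn 0).
Qed.

Lemma Lhat_pull n a : Lhat D phi lp n a = lp ^+ n *: pull (Lop n a).
Proof.
rewrite /Lhat omul_polyC /Lop pull_sum; congr (_ *: _).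
apply: eq_bigr => i _; rewrite opow_scale pullZ pullXn.
by rewrite rmorphM rmorph_nat.
Qed.
End Pullback.
End Ore.

Local Notation opw D c m := (iter m (oshift D c) (1 : {poly _})).

Arguments bcoef : simpl never.

(** * Expansion of the pulled-back operator in powers of [F] *)

Section Pull.
Variables (K : unitRingType) (D : K -> K).
Hypothesis D_add : forall x y, D (x + y) = D x + D y.
Hypothesis D_mul : forall x y, D (x * y) = D x * y + x * D y.
Variables (R : comNzRingType) (d : R -> R) (i : {rmorphism R -> K}).
Hypothesis d0 : d 0 = 0.
Hypothesis i_d : forall z, i (d z) = D (i z).
Hypothesis i_central : forall z x, i z * x = x * i z.
Variables (phi : {rmorphism K -> K}) (lp : K).
Hypothesis lp_unit : lp \is a GRing.unit.
Hypothesis lp_central : forall x, lp * x = x * lp.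
Hypothesis compat : forall x, D (phi x) = lp * phi (D x).
Variables (u h : R).
Hypothesis D_lp : D lp = i u * lp.

Lemma lpX_central k x : lp ^+ k * x = x * lp ^+ k.
Proof. by elim: k => [|k IH]; rewrite ?mul1r ?mulr1 // exprS -mulrA IH mulrA lp_central mulrA. Qed.

Lemma lpV_central x : lp^-1 * x = x * lp^-1.
Proof. by apply: (mulrI lp_unit); rewrite mulVKr // mulrA lp_central mulrK. Qed.

Lemma D_lpX k : D (lp ^+ k) = k%:R * i u * lp ^+ k.
Proof.
elim: k => [|k IH]; first by rewrite (der1 D_mul) mul0r mul0r.
rewrite exprS D_mul D_lp IH -natr1 mulrDl mulrDl mul1r addrC; congr (_ + _).
  by rewrite lp_central -mulrA -lp_central.
by rewrite mulrA.
Qed.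

Lemma Delta_central c z : Delta D c (i z) = i (d z).
Proof. by rewrite /Delta i_central addrK i_d. Qed.

Lemma Delta_lpX c k : Delta D c (lp ^+ k) = k%:R * i u * lp ^+ k.
Proof. by rewrite /Delta lpX_central addrK D_lpX. Qed.

Definition opq c m : {poly K} := lp ^+ m *: iter m (fun q => lp^-1 *: oshift D c q) 1.

(** Since [lp^m] is central with derivative [m u lp^m], one has [lp^m (D + c) = (D + c - m u) lp^m]:
    each step adds such a left factor, recentred at [F = D + c - h]. *)
Lemma opqS c m : opq c m.+1 = oshift D (c - i h) (opq c m) + i (h - m%:R * u) *: opq c m.
Proof.
rewrite {1}/opq iterS scalerA exprSr mulrK //.
set Q := iter _ _ _.
have := oshiftZ D_add D_mul c (lp ^+ m) Q; rewrite Delta_lpX -scalerA -/(opq c m).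
move=> e; rewrite -[LHS](addrK ((m%:R * i u) *: opq c m)) -e.
rewrite oshift_decomp [in RHS]oshift_decomp -[RHS]addrA -[LHS]addrA; congr (_ + _).
rewrite -scalerDl -scalerBl; congr (_ *: _).
by rewrite rmorphB rmorphM rmorph_nat addrA subrK.
Qed.

Local Notation p := (pcoef d h u).

(** The commutator of [F] with a central coefficient is given by [d], so the Leibniz rule applied to
    [opqS] is the recurrence of [pcoef]. *)
Lemma opq_expand c m :
  opq c m = \sum_(k < m.+1) i (p m k) *: opw D (c - i h) (m - k).
Proof.
elim: m => [|m IH].
  by rewrite big_ord_recl big_ord0 /opq /= pcoef0 rmorph1 !scale1r addr0.
rewrite opqS IH oshift_sum // scaler_sumr; set g := h - m%:R * u.
under eq_bigr => k _ do rewrite oshiftZ // Delta_central -iterS -subSn -1?ltnS //.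
rewrite big_split /= -addrA -big_split /= [RHS]big_ord_recl.
under [in RHS]eq_bigr => k _ do
  rewrite lift0 subSS pcoefSS -addrA rmorphD scalerDl.
rewrite [in RHS]big_split /= [RHS]addrA; congr (_ + _); last first.
  by apply: eq_bigr => k _; rewrite scalerA -rmorphM -scalerDl -rmorphD.
(* The extra last term on the right is zero, so both sums have the same range. *)
have pm : p m m.+1 = 0 by apply: pcoef_gt.
rewrite [in LHS]big_ord_recl [in RHS]big_ord_recr pcoefS0 /= pm rmorph0 scale0r addr0.
by congr (_ + _); apply: eq_bigr => k _; rewrite lift0 subSS.
Qed.

Section Monic.
Variables (n : nat) (M : {poly K}).
Hypothesis n_gt0 : (0 < n)%N.
Hypothesis n_unit : n%:R \is a @GRing.unit K.
Hypothesis sM : (size M <= n.+1)%N.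
Hypothesis M_n : M`_n = 1.
Local Notation M' := (lp ^+ n *: pull D phi lp M).
Local Notation b := (b1 n M).
Local Notation beta := (bcoef D b n.+1 M).
Local Notation c := (lp * phi b).
Hypothesis top1 : p n 1 = 0.

Lemma beta_top : beta n = 1. Proof. by rewrite bcoef_top. Qed.

Lemma beta_pred : beta n.-1 = 0.
Proof.
rewrite /b1; case: n n_gt0 n_unit M_n => // m _ mu Mn.
by rewrite bcoef_pred // Mn mul1r mulVKr // subrr.
Qed.

(** [M] is written in powers of [D + b1], pulled back termwise, and each power is expanded by
    [opq_expand]. The conditional extends the triangular range to a square so that the sums can be
    exchanged. *)
Lemma pull_monic_expand : M' = \sum_(j < n.+1)
  (\sum_(k < n.+1) (if (j <= n - k)%N then
     lp ^+ k * phi (beta (n - k)) * i (p (n - k) (n - k - j)) else 0))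
  *: opw D (c - i h) j.
Proof.
rewrite {1}(bcoef_expand D_add D_mul b sM) pull_sum scaler_sumr.
rewrite (reindex_inj rev_ord_inj) /=.
under [RHS]eq_bigr => j _ do rewrite scaler_suml.
rewrite [RHS]exchange_big /=; apply: eq_bigr => k _.
rewrite subSS (pullZ _ _ lp) pull_opw //; last exact: lpV_central.
have kn : (k <= n)%N by rewrite -ltnS.
(* [lp^(n-k)] is absorbed by [opq], and [lp^k] remains as the weight of the [k]-th coefficient. *)
have -> : lp ^+ n = lp ^+ k * lp ^+ (n - k) by rewrite -exprD subnKC.
rewrite scalerA -mulrA (lpX_central (n - k)) mulrA -scalerA -/(opq _ _) opq_expand.
rewrite scaler_sumr (reindex_inj rev_ord_inj) /=.
pose G j := (lp ^+ k * phi (beta (n - k)) * i (p (n - k) (n - k - j))) *: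
  opw D (c - i h) j.
rewrite (eq_bigr (fun j : 'I_(n - k).+1 => G j)); last first.
  by move=> j _; rewrite subSS subKn -1?ltnS // scalerA.
rewrite (big_ord_widen n.+1 G) ?ltnS ?leq_subr // big_mkcond.
by apply: eq_bigr => j _; rewrite ltnS; case: ifP; rewrite ?scale0r.
Qed.

Lemma bcoef_pull r : (r <= n)%N -> bcoef D (c - i h) n.+1 M' (n - r) =
  \sum_(k < r.+1) lp ^+ k * phi (beta (n - k)) * i (p (n - k) (r - k)).
Proof.
move=> rn; pose G k := lp ^+ k * phi (beta (n - k)) * i (p (n - k) (r - k)).
rewrite pull_monic_expand (bcoef_sum D_add D_mul (c - i h) (fun j =>
  \sum_(k < n.+1) (if (j <= n - k)%N then
     lp ^+ k * phi (beta (n - k)) * i (p (n - k) (n - k - j)) else 0))) ?ltnS ?leq_subr //.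
rewrite (big_ord_widen n.+1 G) ?ltnS // [RHS]big_mkcond; apply: eq_bigr => k _.
rewrite ltnS leq_sub2lE -1?ltnS //; case: ifP => // kr; congr (_ * i (p _ _)).
by rewrite subnAC subKn.
Qed.

(** The coefficient of [F^(n-1)] only collects [p n 1] and [beta n.-1], both zero; by [bcoef_pred]
    this forces the constant term of [F] to be [b1]. *)
Lemma b1_pull : b1 n M' = c - i h.
Proof.
have e0 : M'`_n = 1.
  have := bcoef_pull (leq0n n); rewrite subn0 bcoef_top => ->.
  by rewrite big_ord_recl big_ord0 subn0 beta_top rmorph1 pcoef0 rmorph1 !mulr1 addr0.
have := bcoef_pull n_gt0; rewrite !big_ord_recl big_ord0.
rewrite lift0 /= subn0 subn1 top1 beta_pred !rmorph0 !(mulr0, mul0r) !addr0.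
rewrite /b1; case: (n) n_gt0 n_unit e0 => // m _ mu e0.
by rewrite bcoef_pred // e0 mul1r => /eqP; rewrite subr_eq0 => /eqP ->; rewrite mulKr.
Qed.
End Monic.
End Pull.

(** * Transformation of the invariants *)

Section Transformation.
Variables (K : unitRingType) (D : K -> K).
Hypothesis D_add : forall x y, D (x + y) = D x + D y.
Hypothesis D_mul : forall x y, D (x * y) = D x * y + x * D y.
Hypothesis Q_alg : forall m : nat, (m.+1)%:R \is a @GRing.unit K.
Variables (R : comNzRingType) (d : R -> R) (i : {rmorphism R -> K}).
Hypothesis i_inj : injective i.
Hypothesis i_d : forall z, i (d z) = D (i z).
Hypothesis i_central : forall z x, i z * x = x * i z.
Variables (phi : {rmorphism K -> K}) (lp : K).
Hypothesis lp_unit : lp \is a GRing.unit.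
Hypothesis lp_central : forall x, lp * x = x * lp.
Hypothesis compat : forall x, D (phi x) = lp * phi (D x).
Variables (u h : R).
Hypothesis D_lp : D lp = i u * lp.

Lemma center_derD x y : d (x + y) = d x + d y.
Proof. by apply: i_inj; rewrite rmorphD !i_d rmorphD D_add. Qed.

Lemma center_derM x y : d (x * y) = d x * y + x * d y.
Proof. by apply: i_inj; rewrite rmorphD !rmorphM !i_d rmorphM D_mul. Qed.

Lemma center_derN x : d (- x) = - d x.
Proof. by apply: i_inj; rewrite rmorphN !i_d rmorphN (derN D_add). Qed.

Lemma center_der_nat m : d m%:R = 0.
Proof. by apply: i_inj; rewrite i_d rmorph_nat rmorph0 (der_nat D_add D_mul). Qed.

Lemma center_natr_reg m (x y : R) : m.+1%:R * x = m.+1%:R * y -> x = y.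
Proof.
by move/(congr1 i); rewrite !rmorphM !rmorph_nat => /(mulrI (Q_alg m)) /i_inj.
Qed.

Variable n : nat.
Hypothesis h2 : 2%:R * h = (n%:R - 1) * u.

Variables (q32 q65 qs qk : R).
Hypotheses (iq32 : i q32 = qfrac K 3 2) (iq65 : i q65 = qfrac K 6 5).
Hypothesis iqs : i qs = qfrac K (n + 1) 6.
Hypothesis iqk : i qk = qfrac K (3 * (5 * n + 7)) (5 * (n + 1)).

(** The rational constants are handled in [R] through this integral relation, the form in which
    [eq_of_lincomb4] uses them. *)
Lemma qfrac_eq q a b : i q = qfrac K a b.+1 -> b.+1%:R * q = a%:R.
Proof.
move=> iq; apply: i_inj; rewrite rmorphM !rmorph_nat iq /qfrac.
by rewrite -commr_nat divrK.
Qed.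

Lemma q32E : 2%:R * q32 = 3%:R. Proof. exact: qfrac_eq iq32. Qed.
Lemma q65E : 5%:R * q65 = 6%:R. Proof. exact: qfrac_eq iq65. Qed.
Lemma qsE : 6%:R * qs = n%:R + 1. Proof. by rewrite natr1 -(addn1 n); apply: qfrac_eq iqs. Qed.
Lemma qkE : 5%:R * (n%:R + 1) * qk = 3%:R * (5%:R * n%:R + 7%:R).
Proof.
have := iqk; rewrite (_ : (5 * (n + 1))%N = (5 * n + 4).+1); last by rewrite mulnDr muln1 addnS.
move/qfrac_eq.
have -> : (5 * n + 4).+1%:R = 5%:R * (n%:R + 1) :> R by rewrite -natr1 natrD natrM; ring.
by rewrite natrM natrD natrM.
Qed.

Definition schw_term := qs * (d u + u * u - q32 * (u * u)).
Local Notation s := schw_term.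

(** From [D lp = u lp] follows [D (D lp) / lp = u' + u^2], so the Schwarzian is a polynomial in [u]
    and [u']. *)
Lemma i_schw : i s = qfrac K (n + 1) 6 * Schwarz D lp.
Proof.
rewrite rmorphM iqs; congr (_ * _).
have e1 : D lp / lp = i u by rewrite D_lp mulrK.
have e2 : D (D lp) / lp = i (d u + u * u).
  by rewrite D_lp D_mul mulrDl D_lp !mulrA mulrK // rmorphD mulrK // rmorphM i_d.
by rewrite /Schwarz e1 e2 rmorphB !rmorphM iq32.
Qed.

Lemma schwE : 12%:R * s = (n%:R + 1) * (2%:R * d u - u * u).
Proof.
apply: (eq_of_lincomb4 qsE q32E q32E q32E (a := 2%:R * (d u + u * u - q32 * (u * u)))
  (b := - ((n%:R + 1) * (u * u))) (c := 0) (e := 0)).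
rewrite /schw_term; ring.
Qed.

Lemma center_der_qfrac q a b : b.+1%:R * q = a%:R -> d q = 0.
Proof.
move/(congr1 d); rewrite center_derM !center_der_nat mul0r add0r => e.
by apply: (@center_natr_reg b); rewrite e mulr0.
Qed.

Local Notation p := (pcoef d h u).
Variable M : {poly K}.
Hypothesis n_ge3 : (3 <= n)%N.
Hypothesis sM : (size M <= n.+1)%N.
Hypothesis M_n : M`_n = 1.
Local Notation M' := (lp ^+ n *: pull D phi lp M).
Local Notation b := (b1 n M).
Local Notation c' := (lp * phi b - i h).
Local Notation X k := (lp ^+ k * phi (Ik D n M k)).
Local Notation Y k x := (lp ^+ k * phi (Delta D b x)).

Let n_gt0 : (0 < n)%N. Proof. exact: leq_trans n_ge3. Qed.
Let nK : n%:R \is a @GRing.unit K. Proof. by case: n n_gt0. Qed.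
Let binK k : (k <= n)%N -> 'C(n, k)%:R \is a @GRing.unit K.
Proof. by rewrite -bin_gt0; case: 'C(n, k). Qed.

Let ptop1 : p n 1 = 0.
Proof. exact: (pcoef_top1 center_der_nat center_natr_reg h2). Qed.

Lemma b1E : b1 n M' = c'.
Proof.
exact: (b1_pull D_add D_mul (center_der_nat 0) i_d i_central lp_unit lp_central compat D_lp).
Qed.

Lemma binIk k : (k <= n)%N ->
  lp ^+ k * phi (bcoef D b n.+1 M (n - k)) = 'C(n, k)%:R * X k.
Proof.
move=> kn; rewrite /Ik rmorphM rmorphV ?binK // rmorph_nat.
by rewrite [RHS]mulrA -(commr_nat (lp ^+ k)) -mulrA mulVKr ?binK.
Qed.

(** By [b1E], the coordinates computed in [bcoef_pull] are those that define [I_r] of the new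
    operator. *)
Lemma Ik_pull r : (r <= n)%N -> 'C(n, r)%:R * Ik D n M' r =
  \sum_(k < r.+1) 'C(n, k)%:R * i (p (n - k) (r - k)) * X k.
Proof.
move=> rn; rewrite /Ik mulrA divrr ?binK // mul1r b1E.
rewrite (bcoef_pull D_add D_mul (center_der_nat 0) i_d i_central
  lp_unit lp_central compat h D_lp) //.
apply: eq_bigr => k _; rewrite binIk; last by rewrite (leq_trans _ rn) // -ltnS.
by rewrite -[LHS]mulrA -[RHS]mulrA i_central.
Qed.

(** With the next lemma: the formula for [Ik] gives [I_0 = 1] and [I_1 = 0], so only [k = 0] and
    [k >= 2] survive in [Ik_pull]. *)
Lemma lead_weight : X 0 = 1.
Proof. by rewrite /Ik bin0 invr1 !mul1r subn0 bcoef_top M_n rmorph1. Qed.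

Lemma subleading_weight : X 1 = 0.
Proof.
by rewrite /Ik subn1 (beta_pred D_add D_mul n_gt0 nK M_n) mulr0 rmorph0 mulr0.
Qed.

Lemma Ik2_pull : Ik D n M' 2 = i s + X 2.
Proof.
apply: (mulrI (binK (ltnW n_ge3))); rewrite Ik_pull ?(ltnW n_ge3) //.
rewrite !big_ord_recl big_ord0 /= lead_weight subleading_weight pcoef0.
rewrite rmorph1 !mulr1 mulr0 add0r addr0.
rewrite bin0 mul1r subn0 (pcoef_top2 center_derD center_derM center_der_nat center_derN
    center_natr_reg h2 schwE).
by rewrite rmorphM rmorph_nat mulrDr.
Qed.

Lemma Ik3_pull : Ik D n M' 3 = i (q32 * d s) + i (3%:R * u) * X 2 + X 3.
Proof.
apply: (mulrI (binK n_ge3)); rewrite Ik_pull //.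
rewrite !big_ord_recl big_ord0 /= lead_weight subleading_weight pcoef0.
rewrite rmorph1 !mulr1 mulr0 add0r addr0.
have -> : p (n - 0) 3 = 'C(n, 3)%:R * (q32 * d s).
  rewrite subn0; apply: (@center_natr_reg 1).
  rewrite (pcoef_top3 center_derD center_derM center_der_nat center_derN
    center_natr_reg h2 schwE).
  by rewrite -q32E; ring.
rewrite bin0 mul1r /bump /= -(rmorph_nat i 'C(n, 2)) -rmorphM.
rewrite (@pcoef_sub21 _ _ center_der_nat center_natr_reg n h u h2) ?subn2; last first.
  by case: n n_ge3 => [|[|]].
by rewrite !(rmorphM, rmorph_nat) !mulrDr !mulrA addrA.
Qed.

(** Here [q32 - 1] stands for the [1/2] left by [pcoef_sub22], and [q32 * q65] for the [9/5] of
    [pcoef_top4]. *)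
Lemma Ik4_pull : (4 <= n)%N -> Ik D n M' 4 =
  i (q32 * q65 * d (d s) + qk * (s * s))
  + i ((n%:R + 5%:R) * d u + (13%:R - n%:R) * (q32 - 1) * (u * u)) * X 2
  + i (6%:R * u) * X 3 + X 4.
Proof.
move=> n_ge4; apply: (mulrI (binK n_ge4)); rewrite Ik_pull //.
rewrite !big_ord_recl big_ord0 /= lead_weight subleading_weight pcoef0.
rewrite rmorph1 !mulr1 mulr0 add0r addr0.
have -> : p (n - 0) 4 = 'C(n, 4)%:R * (q32 * q65 * d (d s) + qk * (s * s)).
  (* Multiplying by [n+1] and by [10] makes twice the left side of [pcoef_top4] appear. *)
  rewrite subn0; apply: (@center_natr_reg n); rewrite -natr1; apply: (@center_natr_reg 9).
  apply: (eq_of_lincomb4 (pcoef_top4 center_derD center_derM center_der_nat center_derN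
    center_natr_reg h2 schwE) q32E q65E qkE
    (a := 2%:R) (b := - 'C(n, 4)%:R * (n%:R + 1) * 5%:R * q65 * d (d s))
    (c := - 'C(n, 4)%:R * (n%:R + 1) * 3%:R * d (d s)) (e := - 'C(n, 4)%:R * 2%:R * (s * s))).
  ring.
rewrite bin0 mul1r /bump /= -(rmorph_nat i 'C(n, 2)) -(rmorph_nat i 'C(n, 3)) -!rmorphM.
have n3 : n = (n - 3).+3 by rewrite -addn3 subnK // ltnW.
rewrite (pcoef_sub31 center_der_nat center_natr_reg h2 n3).
have -> : 'C(n, 2)%:R * p (n - 2) 2 =
    'C(n, 4)%:R * ((n%:R + 5%:R) * d u + (13%:R - n%:R) * (q32 - 1) * (u * u)).
  have nE : n = (n - 2).+2 by rewrite -addn2 subnK // ltnW.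
  have e := pcoef_sub22 center_derD center_derM center_der_nat center_derN center_natr_reg h2 nE.
  apply: (@center_natr_reg 1).
  apply: (eq_of_lincomb4 e q32E e e (a := 1)
    (b := - 'C(n, 4)%:R * (13%:R - n%:R) * (u * u)) (c := 0) (e := 0)).
  ring.
by rewrite !rmorphM !rmorph_nat !mulrDr !mulrA !addrA.
Qed.

Lemma DeltaD c x y : Delta D c (x + y) = Delta D c x + Delta D c y.
Proof. by rewrite /Delta D_add mulrDr mulrDl opprD [Z in Z + _ = _]addrACA [LHS]addrACA. Qed.

Lemma DeltaM c x y : Delta D c (x * y) = Delta D c x * y + x * Delta D c y.
Proof.
rewrite /Delta D_mul mulrBl mulrBr mulrDl mulrDr !mulrA !addrA; congr (_ - _).
by rewrite [RHS]addrAC subrK addrAC.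
Qed.

Lemma DeltaM_i c z x : Delta D c (i z * x) = i (d z) * x + i z * Delta D c x.
Proof. by rewrite DeltaM (Delta_central i_d i_central). Qed.

Lemma DeltaB_central c z x : Delta D (c - i z) x = Delta D c x.
Proof.
rewrite /Delta mulrBl mulrBr (i_central z) opprB -!addrA; congr (_ + (_ + _)).
by rewrite addKr.
Qed.

Lemma Delta_phi c x : Delta D (lp * phi c) (phi x) = lp * phi (Delta D c x).
Proof.
rewrite /Delta compat rmorphB rmorphD !rmorphM mulrBr mulrDr !mulrA.
by rewrite (lp_central (phi x)).
Qed.

Local Notation delta x := (Delta D (b1 n M') x).

Lemma delta_i z : delta (i z) = i (d z).
Proof. exact: (Delta_central i_d i_central). Qed.

(** The central shift [h] drops out of the commutator, [lp^k] contributes [k u], and [compat] turns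
    [Delta] at [lp * phi b] into one more power of [lp]. *)
Lemma delta_X k x :
  delta (lp ^+ k * phi x) = i (k%:R * u) * (lp ^+ k * phi x) + Y k.+1 x.
Proof.
rewrite b1E DeltaB_central DeltaM (Delta_lpX D_mul lp_central D_lp) Delta_phi.
by rewrite rmorphM rmorph_nat exprSr !mulrA.
Qed.

(* Linear combinations over the commutative ring [R]: the noncommutative identities for
   [W_3] and [W_4] become coefficientwise identities in [R]. *)
Section Combination.
Variable v : nat -> K.
Definition lin (f : nat -> R) : K := \sum_(j < 8) i (f j) * v j.

Lemma linD f g : lin f + lin g = lin (fun j => f j + g j).
Proof. by rewrite -big_split; apply: eq_bigr => j _; rewrite rmorphD mulrDl. Qed.

Lemma linN f : - lin f = lin (fun j => - f j).
Proof. by rewrite -sumrN; apply: eq_bigr => j _; rewrite rmorphN mulNr. Qed.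

Lemma linZ z f : i z * lin f = lin (fun j => z * f j).
Proof. by rewrite mulr_sumr; apply: eq_bigr => j _; rewrite rmorphM mulrA. Qed.

Lemma lin_basis k : (k < 8)%N -> v k = lin (fun j => (j == k)%:R).
Proof.
move=> k8; rewrite /lin (bigD1 (Ordinal k8)) //= eqxx rmorph1 mul1r big1 ?addr0 //.
by move=> j /negPf; rewrite -val_eqE /= => ->; rewrite rmorph0 mul0r.
Qed.

Lemma eq_lin f g : (forall j, (j < 8)%N -> f j = g j) -> lin f = lin g.
Proof. by move=> fg; apply: eq_bigr => j _; rewrite fg. Qed.
End Combination.

Lemma phi_qfrac k a e x :
  lp ^+ k * phi (qfrac K a e.+1 * x) = qfrac K a e.+1 * (lp ^+ k * phi x).
Proof.
rewrite rmorphM /qfrac rmorph_div // !rmorph_nat !mulrA; congr (_ * _).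
by rewrite -mulrA (lpX_central lp_central).
Qed.

Lemma phi_natM k a x : lp ^+ k * phi (a%:R * x) = a%:R * (lp ^+ k * phi x).
Proof. by rewrite rmorphM rmorph_nat !mulrA (commr_nat (lp ^+ k)). Qed.

Lemma W2_pull : W2 D n M' = lp ^+ 2 * phi (W2 D n M) + qfrac K (n + 1) 6 * Schwarz D lp.
Proof. by rewrite /W2 Ik2_pull i_schw addrC. Qed.

Local Notation I2 := (Ik D n M 2).
Local Notation I3 := (Ik D n M 3).

Lemma delta_Ik2 : delta (Ik D n M' 2) = i (d s) + i (2%:R * u) * X 2 + Y 3 I2.
Proof. by rewrite Ik2_pull DeltaD delta_i delta_X addrA. Qed.

(** The entry [1] carries the terms in [u] and [s] alone. No linear independence is claimed: equal
    coefficients suffice. *)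
Definition basis (j : nat) : K :=
  nth 0 [:: 1; X 2; Y 3 I2; X 3; X 4; Y 4 I3; Y 4 (Delta D b I2); X 2 * X 2] j.

Lemma W3_pull : W3 D n M' = lp ^+ 3 * phi (W3 D n M).
Proof.
have -> : lp ^+ 3 * phi (W3 D n M) = X 3 - i q32 * Y 3 I2.
  by rewrite /W3 rmorphB mulrBr phi_qfrac -iq32.
rewrite /W3 delta_Ik2 Ik3_pull -iq32.
rewrite -[i (q32 * d s)]mulr1 -[i (d s)]mulr1.
rewrite -[1]/(basis 0) -[X 2]/(basis 1) -[Y 3 I2]/(basis 2) -[X 3]/(basis 3).
do 4!rewrite [basis _]lin_basis //.
rewrite !(linZ, linD, linN); apply: eq_lin => j _.
case: j => [|[|[|[|j]]]] /=; try ring.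
(* Only the coefficient of [X 2], namely [3 u - q32 * 2 u], depends on the value [3/2]. *)
by apply: (eq_of_lincomb4 q32E q32E q32E q32E (a := - u) (b := 0) (c := 0) (e := 0)); ring.
Qed.

Lemma W4_pull : (4 <= n)%N -> W4 D n M' = lp ^+ 4 * phi (W4 D n M).
Proof.
move=> n_ge4.
have d3 : d (3%:R * u) = 3%:R * d u by rewrite center_derM center_der_nat mul0r add0r.
have d2 : d (2%:R * u) = 2%:R * d u by rewrite center_derM center_der_nat mul0r add0r.
have dt : d (q32 * d s) = q32 * d (d s) by rewrite center_derM (center_der_qfrac q32E) mul0r add0r.
have -> : lp ^+ 4 * phi (W4 D n M) =
    X 4 - 2%:R * Y 4 I3 + i q65 * Y 4 (Delta D b I2) - i qk * (X 2 * X 2).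
  have -> : X 2 * X 2 = lp ^+ 4 * phi (I2 * I2).
    have cX := lpX_central lp_central 2 (phi I2).
    by rewrite rmorphM -mulrA [phi I2 * (_ * _)]mulrA -cX -mulrA mulrA -exprD.
  have e : (5 * (n + 1))%N = (5 * n + 4).+1 by rewrite mulnDr muln1 addnS.
  rewrite /W4 iq65 iqk e rmorphB rmorphD rmorphB mulrBr mulrDr mulrBr !phi_qfrac.
  by rewrite phi_natM.
have dI3 : delta (Ik D n M' 3) = i (q32 * d (d s)) + i (3%:R * d u) * X 2
    + i (3%:R * u) * (i (2%:R * u) * X 2 + Y 3 I2) + i (3%:R * u) * X 3 + Y 4 I3.
  by rewrite Ik3_pull !DeltaD DeltaM_i delta_i dt !delta_X d3 !addrA.
have ddI2 : delta (delta (Ik D n M' 2)) = i (d (d s)) + i (2%:R * d u) * X 2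
    + i (2%:R * u) * (i (2%:R * u) * X 2 + Y 3 I2) + i (3%:R * u) * Y 3 I2
    + Y 4 (Delta D b I2).
  by rewrite delta_Ik2 !(DeltaD (b1 n M')) DeltaM_i delta_i !delta_X d2 !addrA.
have sq : Ik D n M' 2 * Ik D n M' 2 = i (s * s) + i (2%:R * s) * X 2 + X 2 * X 2.
  rewrite Ik2_pull mulrDl !mulrDr -(i_central s (X 2)) -!addrA rmorphM; congr (_ + _).
  by rewrite addrA -mulrDl -rmorphD -mulr2n mulr_natl.
rewrite /W4 dI3 ddI2 sq (Ik4_pull n_ge4) -iq65 -iqk -(rmorph_nat i 2).
rewrite -[i (q32 * q65 * d (d s) + _)]mulr1 -[i (q32 * d (d s))]mulr1.
rewrite -[i (d (d s))]mulr1 -[i (s * s)]mulr1.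
rewrite -[X 2 * X 2]/(basis 7) -[1]/(basis 0) -[X 2]/(basis 1) -[Y 3 I2]/(basis 2).
rewrite -[X 3]/(basis 3) -[X 4]/(basis 4) -[Y 4 I3]/(basis 5).
rewrite -[Y 4 (Delta D b I2)]/(basis 6).
do 8!rewrite [basis _]lin_basis //.
rewrite !(linZ, linD, linN); apply: eq_lin => j _.
(* The coefficients of [1], [X 2] and [Y 3 I2] depend on the values of the constants; the others,
   such as [6 u - 2 * 3 u] at [X 3], are ring identities. *)
case: j => [|[|[|j]]] /=; last by ring.
- apply: (@center_natr_reg 9).
  apply: (eq_of_lincomb4 q32E q65E q65E q65E (a := (5%:R * q65 - 10%:R) * d (d s))
    (b := 5%:R * d (d s)) (c := 0) (e := 0)).
  ring.
(* At [X 2] the cross term [2 qk s] of the square has to cancel the polynomial in [u] and [u']: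
   [schwE] and [qkE] give its value, and [60] clears denominators. *)
- apply: (@center_natr_reg 59).
  apply: (eq_of_lincomb4 q32E q65E schwE qkE
    (a := 30%:R * (13%:R - n%:R) * (u * u)) (b := 12%:R * (4%:R * (u * u) + 2%:R * d u))
    (c := - (10%:R * qk)) (e := - (2%:R * (2%:R * d u - u * u)))).
  ring.
- apply: (eq_of_lincomb4 q65E q65E q65E q65E (a := u) (b := 0) (c := 0) (e := 0)).
  ring.
Qed.


End Transformation.

(** * The operator [L] and the assembly of the theorem *)

Lemma size_Lop (K : unitRingType) n (a : nat -> K) : (size (Lop n a) <= n.+1)%N.
Proof.
apply: (leq_trans (size_sum _ _ _)); apply/bigmax_leqP => i _.
apply: (leq_trans (size_scale_leq _ _)).
by rewrite size_polyXn ltnS leq_subr.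
Qed.

Lemma coef_Lop_top (K : unitRingType) n (a : nat -> K) : (Lop n a)`_n = a 0%N.
Proof.
rewrite /Lop coef_sum big_ord_recl coefZ coefXn subn0 eqxx bin0 mul1r mulr1.
rewrite big1 ?addr0 // => i _; rewrite coefZ coefXn lift0.
by rewrite gtn_eqF ?mulr0 // ltn_subrL (leq_ltn_trans _ (ltn_ord i)).
Qed.

Theorem mainTheorem11 (K : unitRingType) (D : K -> K)
  (D_add : forall x y, D (x + y) = D x + D y)
  (D_mul : forall x y, D (x * y) = D x * y + x * D y)
  (Q_alg : forall m : nat, (m.+1)%:R \is a @GRing.unit K)
  (phi : {rmorphism K -> K}) (phi_bij : bijective phi)
  (lp : K) (lp_unit : lp \is a GRing.unit)
  (lp_central : forall (j : nat) (x : K), iter j D lp * x = x * iter j D lp)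
  (compat : forall x, D (phi x) = lp * phi (D x))
  (n : nat) (a : nat -> K) (a0 : a 0%N = 1) :
  let L := Lop n a in
  let Lh := Lhat D phi lp n a in
  ((3 <= n)%N ->
     W2 D n Lh = lp ^+ 2 * phi (W2 D n L) + qfrac K (n + 1) 6 * Schwarz D lp
  /\ W3 D n Lh = lp ^+ 3 * phi (W3 D n L))
  /\ ((4 <= n)%N -> W4 D n Lh = lp ^+ 4 * phi (W4 D n L)).
Proof.
move=> L Lh.
have [R [d [i [i_inj i_d i_central i_onto]]]] := differential_center D_add D_mul.
have lpC := lp_central 0%N.
(* All derivatives of [lp] being central, [lp], its derivative and its inverse lie in the
   differential centre, so the logarithmic derivative lifts to [R]. *)
have [u iu] : exists u, i u = D lp / lp.
  by apply: i_onto; apply: dcentralM => //; [exact: dcentral_der | exact: dcentralV].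
have D_lp : D lp = i u * lp by rewrite iu divrK.
have qf p q : exists z, i z = qfrac K p q.+1.
  by apply: i_onto; apply: dcentralM => //; [|apply: dcentralV => //]; exact: dcentral_nat.
have [q12 i12] := qf 1%N 1%N; have [q32 iq32] := qf 3%N 1%N; have [q65 iq65] := qf 6%N 4%N.
have [qs iqs] := qf (n + 1)%N 5%N.
have [qk iqk] := qf (3 * (5 * n + 7))%N (5 * n + 4)%N.
(* [qf] takes the predecessor of the denominator, here that of [5 * (n + 1)]. *)
have e : (5 * n + 4).+1 = (5 * (n + 1))%N by rewrite mulnDr muln1 [RHS]addnS.
rewrite e in iqk.
pose h := q12 * ((n%:R - 1) * u).
have h2 : 2%:R * h = (n%:R - 1) * u.
  by rewrite /h mulrA (qfrac_eq Q_alg i_inj i12) mul1r.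
have sM : (size L <= n.+1)%N := size_Lop n a.
have M_n : L`_n = 1 by rewrite /L coef_Lop_top a0.
rewrite /Lh (Lhat_pull D_add D_mul).
split=> [n3 | n4]; first split.
- exact: (W2_pull D_add D_mul Q_alg i_inj i_d i_central lp_unit lpC compat D_lp h2 iq32 iqs).
- exact: (W3_pull D_add D_mul Q_alg i_inj i_d i_central lp_unit lpC compat D_lp h2 iq32 iqs).
exact: (W4_pull D_add D_mul Q_alg i_inj i_d i_central lp_unit lpC compat D_lp h2 iq32 iq65 iqs iqk
  (ltnW n4) sM M_n n4).
Qed.
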